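(* If a graph $G=(V,E)$ has doubling dimension $d$, then it admits a strong-diameter $(\rho,\mu)$-hierarchical partition family $\mathfrak{P}$ of size $2^{\tilde{O}(d)}$ with $\rho = O(1)$ and $\mu = \tilde{O}(d^3)$, such that the maximum degree of any cluster in any hierarchical partition in $\mathfrak{P}$ is at most $\mu^{O(d)}$.
   Context: $G$ is a connected edge-weighted graph; its doubling dimension is that of its shortest-path metric $d_G$ (every ball of radius $r>0$ can be covered by at most $2^d$ balls of radius $r/2$). A strong-diameter $\mu$-hierarchical partition ($\mu$-HP) of $G$ is a sequence of partitions $\mathbb{P}=(P_0,P_1,\dots,P_{i_{\max}})$ of $V$ such that: every cluster of $P_0$ is a single vertex and $P_{i_{\max}}$ consists of one cluster containing all vertices; for every $i$, every cluster $C\in P_i$ satisfies $\max_{u,v\in C} d_{G[C]}(u,v)\le \mu^i$ (strong diameter, measured in the induced subgraph $G[C]$); and every cluster of $P_i$ is a union of clusters of $P_{i-1}$. Viewing $\mathbb{P}$ as a tree, the children of $C\in P_i$ are the clusters of $P_{i-1}$ whose union is $C$, and the degree of $C$ is its number of children. A strong-diameter $(\rho,\mu)$-hierarchical partition family ($(\rho,\mu)$-HPF) is a set $\mathfrak{P}=\{\mathbb{P}^1,\dots,\mathbb{P}^\sigma\}$ of strong-diameter $\mu$-HPs such that for every vertex $v$ and every $i\in\mathbb{N}$ there exist $j$ and a cluster $C$ in the scale-$i$ partition $P^j_i$ of $\mathbb{P}^j$ with the ball $B(v,\mu^i/\rho)=\{u: d_G(u,v)\le \mu^i/\rho\}$ contained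 in $C$. $\sigma$ is the size, $\rho$ the padding, $\mu$ the growth factor. $\tilde O(g)$ hides polylogarithmic factors in $g$.
   Formalization: All edge weights are assumed to be at least 1: for a two-vertex graph with edge weight below 1/ρ the ball B(v,1/ρ) contains both vertices and lies in no single-vertex cluster of P_0, so the claim fails without this normalization. *)

(* Defs.v *)
From mathcomp Require Import all_boot all_order all_algebra.
From mathcomp Require Import all_classical all_reals all_analysis.

Set Implicit Arguments.
Unset Strict Implicit.
Unset Printing Implicit Defensive.
Import Order.TTheory GRing.Theory Num.Theory.
Local Open Scope ring_scope.

Record wgraph (R : realType) (V : finType) := WGraph {
  adj : rel V;
  weight : V -> V -> R;
  adj_sym : symmetric adj;
  adj_irrefl : irreflexive adj;
  weight_sym : forall u v, weight u v = weight v u;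
  weight_gt0 : forall u v, adj u v -> 0 < weight u v
}.

Section Graph.
Variables (R : realType) (V : finType) (G : wgraph R V).

Definition gconnected : Prop :=
  (0 < #|V|)%N /\ forall u v : V, connect (adj G) u v.

Fixpoint walk_length (u : V) (p : seq V) : R :=
  if p is w :: q then weight G u w + walk_length w q else 0.

(* The vertices of the walk are u :: p. *)
Definition is_walk (C : {set V}) (u v : V) (p : seq V) : Prop :=
  [/\ path (adj G) u p, last u p = v & all (mem C) (u :: p)].

(* The distance d_{G[C]} in the induced subgraph, whose walks are the walks of
   G staying in C; it is +oo when C contains no walk from u to v. *)
Definition dist_in (C : {set V}) (u v : V) : \bar R :=
  ereal_inf [set (walk_length u p)%:E | p in is_walk C u v]%classic.

Definition dist (u v : V) : \bar R := dist_in [set: V]%SET u v.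

Definition gball (v : V) (r : R) : {set V} :=
  [set u : V | (dist v u <= r%:E)%E]%SET.

(* d is not required to be minimal. *)
Definition has_doubling_dim (d : R) : Prop :=
  forall (v : V) (r : R), 0 < r ->
    exists2 S : {set V}, #|S|%:R <= 2 `^ d :> R
      & gball v r \subset \bigcup_(x in S) gball x (r / 2).

(* A hierarchical partition is the list P_0, ..., P_imax; beyond imax the
   partition is the trivial one {V}. *)
Definition level (P : seq {set {set V}}) (i : nat) : {set {set V}} :=
  nth [set [set: V]]%SET P i.

(* C is meant to be a cluster of level i.+1. *)
Definition children (P : seq {set {set V}}) (i : nat) (C : {set V}) :
    {set {set V}} :=
  [set D in level P i | D \subset C]%SET.

Definition strong_hp (mu : R) (P : seq {set {set V}}) : Prop :=
  [/\ (0 < size P)%N,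
      forall i, (i < size P)%N -> finset.partition (level P i) [set: V]%SET,
      (forall C, C \in level P 0 -> #|C| = 1%N) /\
        level P (size P).-1 = [set [set: V]]%SET,
      forall i C, (i < size P)%N -> C \in level P i ->
        forall u v, u \in C -> v \in C -> (dist_in C u v <= (mu ^+ i)%:E)%E
    & forall i C, (i.+1 < size P)%N -> C \in level P i.+1 ->
        finset.cover (children P i C) = C].

Definition strong_hpf (rho mu : R) (F : seq (seq {set {set V}})) : Prop :=
  [/\ 0 < rho, 1 < mu, forall P, P \in F -> strong_hp mu P
    & forall (v : V) (i : nat), exists2 P, P \in F &
        exists2 C, C \in level P i & gball v (mu ^+ i / rho) \subset C].

Definition max_degree_le (P : seq {set {set V}}) (b : R) : Prop :=
  forall i C, (i.+1 < size P)%N -> C \in level P i.+1 ->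
    #|children P i C|%:R <= b.

End Graph.

(* Asymptotic bounds in one real parameter. They hold for all d >= 1, not only
   for large d: a metric with at least two points has doubling dimension at
   least 1. *)
Definition is_bigO (R : realType) (f g : R -> R) : Prop :=
  exists c : R, forall d, 1 <= d -> `|f d| <= c * g d.

(* The shift by 2 keeps the logarithm above 1 when g d >= 0. *)
Definition is_softO (R : realType) (f g : R -> R) : Prop :=
  exists (c : R) (k : nat), forall d, 1 <= d ->
    `|f d| <= c * g d * ln (2 + g d) ^+ k.

(* Main.v *)
(* A family member is built bottom-up.  At scale [i] it receives a set [N] of far
   apart net points whose balls have to be padded, and coarsens a partition into
   clusters of diameter [Dl = mu^(i-1)].  The set [N] is extended to a maximal
   separated set [S] of portals; each portal takes the old clusters meeting its
   ball of radius [mu Dl / 12], and the others are aggregated to portals in [h]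
   phases.  In a phase every portal [s] in turn considers the free vertices [v]
   with [d(v, s) <= d(v, S) + r] and raises [r] by steps of [2 Dl] until a step no
   longer doubles the number of clusters met; it then takes the clusters met before
   that step.  The clusters left free at the end of the phase are charged to the
   ones taken nearby, so the number of free clusters is halved locally.  A ball of
   radius [h mu Dl] meets fewer than [2^(h-1)] clusters (each contains a portal), so
   [h = O(d log d)] phases use up all clusters, with an additive cost
   [2 h^2 Dl <= mu Dl / 4].  Since a net can be coloured with [2^O(d)] colours
   such that points of one colour are far apart, that many members suffice. *)

Require Import Defs.
From mathcomp Require Import all_boot all_order all_algebra.
From mathcomp Require Import all_classical all_reals all_analysis.
From mathcomp Require Import zify lra.
Import Order.TTheory GRing.Theory Num.Theory.
Local Open Scope ring_scope.

Set Implicit Arguments.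
Unset Strict Implicit.
Unset Printing Implicit Defensive.

(** * Walks, nets and colourings *)

Lemma card_bigcup_le (I T : finType) (S : {set I}) (F : I -> {set T}) :
  (#|\bigcup_(i in S) F i| <= \sum_(i in S) #|F i|)%N.
Proof.
elim/big_rec2: _ => [|i n A _ le_An]; first by rewrite cards0.
by rewrite (leq_trans (leq_card_setU _ _)) // leq_add2l.
Qed.

Lemma proper_coloring (T : finType) (e : rel T) (K : nat) (Y : {set T}) :
  symmetric e ->
  (forall y, y \in Y -> (#|[set z in Y | e y z & z != y]%SET| < K)%N) ->
  exists col : T -> nat,
    (forall y, y \in Y -> (col y < K)%N) /\
    (forall y z, y \in Y -> z \in Y -> e y z -> col y = col z -> y = z).
Proof.
move=> e_sym; move: {2}#|Y| (erefl #|Y|) => n; elim: n Y => [|n IH] Y cardY degY.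
  exists (fun=> 0%N); split=> [y|y z]; by rewrite (cards0_eq cardY) inE.
have [y0 y0Y] : exists y, y \in Y by apply/card_gt0P; rewrite cardY.
have cardY0 : #|(Y :\ y0)%SET| = n by move: cardY; rewrite (cardsD1 y0) y0Y => -[].
have subY0 y : y \in (Y :\ y0)%SET -> y \in Y by rewrite !inE => /andP[].
case: (IH _ cardY0) => [y yY|col [colK colP]].
  apply: leq_ltn_trans (degY y (subY0 y yY)).
  by apply/subset_leq_card/fintype.subsetP => z; rewrite !inE => /andP[/andP[_ ->]].
pose nb := [set z in Y | e y0 z & z != y0]%SET.
have [k] : exists k : 'I_K,
    k \notin [seq k : 'I_K | k : 'I_K <- enum 'I_K & has (fun z => col z == k) (enum nb)].
  apply/existsP; rewrite -[X in is_true X]negbK negb_exists; apply/negP => /forallP allk.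
  have : (K <= #|nb|)%N.
    have <- : size (iota 0 K) = K by rewrite size_iota.
    rewrite -(size_image col nb); apply: uniq_leq_size; first exact: iota_uniq.
    move=> i; rewrite mem_iota /= add0n => ltiK.
    move: (allk (Ordinal ltiK)); rewrite negbK => /mapP[k].
    rewrite mem_filter => /andP[/hasP[z znb /eqP colz] _] ik.
    by apply/mapP; exists z => //; rewrite colz -ik.
  by rewrite leqNgt degY.
move=> kP; exists (fun y => if y == y0 then k : nat else col y); split=> [y yY|y z yY zY eyz].
  by case: eqVneq => [//|ne]; apply: colK; rewrite !inE ne.
have kfree x : x \in Y -> e y0 x -> x != y0 -> col x = k -> False.
  move=> xY ex ne colx; move/negP: kP; apply; apply/mapP; exists k => //.
  rewrite mem_filter mem_enum andbT; apply/hasP; exists x; last by rewrite colx.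
  by rewrite mem_enum !inE xY ex.
case: (eqVneq y y0) => [yE|ney]; case: (eqVneq z y0) => [zE|nez] //; first by rewrite yE zE.
- by move=> /esym colz; case: (kfree z) => //; rewrite -yE.
- by move=> coly; case: (kfree y) => //; rewrite e_sym -zE.
- by apply: colP => //; rewrite !inE ?ney ?nez.
Qed.

Section Walks.
Variables (R : realType) (V : finType) (G : wgraph R V).
Hypothesis weight_ge1 : forall u v, adj G u v -> 1 <= weight G u v.

Definition reach (C : {set V}) (u v : V) (l : R) : Prop :=
  exists2 p, is_walk G C u v p & walk_length G u p <= l.

Lemma walk_length_cat u p q :
  walk_length G u (p ++ q) = walk_length G u p + walk_length G (last u p) q.
Proof. by elim: p u => [|w p IH] u /=; rewrite ?add0r // IH addrA. Qed.

Lemma size_walk_length u p : path (adj G) u p -> (size p)%:R <= walk_length G u p.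
Proof.
elim: p u => [|w p IH] u //= /andP[uw wp].
by rewrite -natr1 addrC lerD // ?weight_ge1 ?IH.
Qed.

Lemma walk_length_ge0 u p : path (adj G) u p -> 0 <= walk_length G u p.
Proof. by move=> /size_walk_length; apply: le_trans. Qed.

Lemma shortest_walk (u : V) (P : seq V -> Prop) :
  (forall p, P p -> path (adj G) u p) -> (exists p, P p) ->
  exists2 p, P p & forall q, P q -> walk_length G u p <= walk_length G u q.
Proof.
move=> pathP [p0 Pp0]; pose n := Num.truncn (walk_length G u p0).
have small q : P q -> walk_length G u q <= walk_length G u p0 -> (size q <= n)%N.
  move=> Pq le_q; rewrite -ltnS -(ltr_nat R).
  apply: le_lt_trans (truncnS_gt (walk_length G u p0)).
  exact: le_trans (size_walk_length (pathP _ Pq)) le_q.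
pose i0 : n.-bseq V := Bseq (small p0 Pp0 (lexx _)).
have Pi0 : `[< P i0 >] by apply/asboolP.
case: (@arg_minP _ R (n.-bseq V) i0 (fun q => `[< P q >])
  (fun q => walk_length G u q) Pi0) => p /asboolP Pp minp.
exists p => // q Pq; have [le_q|/ltW le_q] := leP (walk_length G u q) (walk_length G u p0).
  by apply: (minp (Bseq (small q Pq le_q))); apply/asboolP.
exact: le_trans (minp i0 Pi0) le_q.
Qed.

Lemma is_walk_sub (C D : {set V}) u v p :
  C \subset D -> is_walk G C u v p -> is_walk G D u v p.
Proof.
by move=> /fintype.subsetP CD [h1 h2 h3]; split=> //; apply: sub_all h3 => x; apply: CD.
Qed.

Lemma reach_mono (C D : {set V}) u v l m :
  C \subset D -> l <= m -> reach C u v l -> reach D u v m.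
Proof.
move=> CD lm [p wp lp]; exists p; [exact: is_walk_sub wp | exact: le_trans lm].
Qed.

Lemma reach_le (C : {set V}) u v l m : l <= m -> reach C u v l -> reach C u v m.
Proof. exact: reach_mono. Qed.

Lemma reach_setT (C : {set V}) u v l : reach C u v l -> reach [set: V]%SET u v l.
Proof. by apply: reach_mono; rewrite ?finset.subsetT. Qed.

Lemma reach_refl (C : {set V}) u l : u \in C -> 0 <= l -> reach C u u l.
Proof. by move=> uC l0; exists [::] => //; split=> //=; rewrite andbT. Qed.

Lemma reach_trans (C : {set V}) u v w l m :
  reach C u v l -> reach C v w m -> reach C u w (l + m).
Proof.
move=> [p [p1 p2 p3] pl] [q [q1 q2 q3] ql]; exists (p ++ q).
  split; first by rewrite cat_path p1 p2.
    by rewrite last_cat p2.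
  by rewrite -cat_cons all_cat p3; case/andP: q3.
by rewrite walk_length_cat p2 lerD.
Qed.

Lemma reach_edge (C : {set V}) u v :
  u \in C -> v \in C -> adj G u v -> reach C u v (weight G u v).
Proof.
move=> uC vC uv; exists [:: v]; last by rewrite /= addr0.
by split=> //=; rewrite ?uv // uC vC.
Qed.

Lemma reach_sym (C : {set V}) u v l : reach C u v l -> reach C v u l.
Proof.
move=> [p wp lp]; apply: reach_le lp _.
elim: p u wp => [|w p IH] u [/= p1 p2 /andP[uC p3]].
  by rewrite -p2; apply: reach_refl.
case/andP: p1 => uw p1; case/andP: (p3) => wC _.
rewrite addrC; apply: reach_trans (IH w _) _ => //; rewrite weight_sym.
by apply: reach_edge => //; rewrite adj_sym.
Qed.

Lemma reach_ends (C : {set V}) u v l : reach C u v l -> u \in C /\ v \in C.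
Proof.
move=> [p [_ <- /allP wC] _]; split; first by apply: wC; rewrite mem_head.
by apply: wC; rewrite mem_last.
Qed.

Lemma reach_lt1 (C : {set V}) u v l : reach C u v l -> l < 1 -> u = v.
Proof.
move=> [[|w p] [p1 p2 _] pl] l1 //; exfalso.
have := size_walk_length p1; rewrite -natr1.
have : (0 : R) <= (size p)%:R by [].
lra.
Qed.

Lemma dist_inP (C : {set V}) u v l :
  (dist_in G C u v <= l%:E)%E <-> reach C u v l.
Proof.
split=> [le_dl|[p wp lp]]; last first.
  apply: le_trans (_ : (walk_length G u p)%:E <= _)%E; last by rewrite lee_fin.
  by apply: ereal_inf_lbound; exists p.
case: (pselect (exists p, is_walk G C u v p)) => [exw|nw]; last first.
  move: le_dl; rewrite /dist_in (_ : [set _ | _ in _]%classic = set0) ?ereal_inf0 //.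
  by apply/seteqP; split=> // x [p wp _]; case: nw; exists p.
have [|p wp minp] := @shortest_walk u _ _ exw; first by move=> p [].
exists p => //; rewrite -lee_fin; apply: le_trans le_dl.
by apply: le_ereal_inf_tmp => _ [q wq <-]; rewrite lee_fin minp.
Qed.

Lemma in_gball v r u : (u \in gball G v r) = `[< reach [set: V]%SET v u r >].
Proof. by rewrite inE; apply/idP/asboolP => /dist_inP. Qed.

Lemma gballP v r u : reflect (reach [set: V]%SET v u r) (u \in gball G v r).
Proof. by rewrite in_gball; apply: asboolP. Qed.

Definition far_apart (r : R) (A : {set V}) : Prop :=
  forall u v, u \in A -> v \in A -> reach [set: V]%SET u v r -> u = v.

Lemma separated_card (kappa k : nat) (sep L : R) (y : V) (A : {set V}) :
  has_doubling_dim G kappa%:R -> 0 < L -> 2 * L <= sep * 2 ^+ k ->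
  far_apart sep A -> A \subset gball G y L -> (#|A| <= 2 ^ (kappa * k))%N.
Proof.
move=> dd; elim: k L y A => [|k IH] L y A L0 Lsep sepA /fintype.subsetP AL.
  rewrite muln0 expn0; apply/fintype.card_le1_eqP => u v uA vA; apply: sepA => //.
  apply: reach_le (_ : L + L <= _) _; first by rewrite expr0 in Lsep; lra.
  have /gballP yu := AL _ uA; have /gballP yv := AL _ vA.
  exact: reach_trans (reach_sym yv) yu.
have [S cardS] := dd y L L0; rewrite powR_mulrn // -natrX ler_nat in cardS.
move/fintype.subsetP => coverS.
have sub : A \subset (\bigcup_(x in S) (A :&: gball G x (L / 2)))%SET.
  apply/fintype.subsetP => u uA; have /finset.bigcupP[x xS ux] := coverS _ (AL _ uA).
  by apply/finset.bigcupP; exists x => //; rewrite inE uA.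
apply: leq_trans (subset_leq_card sub) _; apply: leq_trans (card_bigcup_le _ _) _.
apply: leq_trans (_ : \sum_(x in S) 2 ^ (kappa * k) <= _)%N.
  apply: leq_sum => x _; apply: (IH (L / 2) x); rewrite ?subsetIr //; first by lra.
    by move: Lsep; rewrite exprS; lra.
  by move=> u v /setIP[uA _] /setIP[vA _]; apply: sepA.
by rewrite sum_nat_const mulnS expnD leq_mul2r cardS orbT.
Qed.

Lemma maximal_separated (r : R) (N : {set V}) :
  0 <= r -> far_apart r N ->
  exists S : {set V}, [/\ N \subset S, far_apart r S &
    forall v, exists2 s, s \in S & reach [set: V]%SET v s r].
Proof.
move=> r0 sepN; pose P A := `[< far_apart r A >].
have [|S /finset.maxsetP[/asboolP sepS maxS] NS] := @finset.maxset_exists _ P N.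
  exact/asboolP.
exists S; split=> // v.
case: (pselect (exists2 s, s \in S & reach [set: V]%SET v s r)) => // none.
have vS : v \notin S.
  by apply/negP => vS; case: none; exists v => //; apply: reach_refl; rewrite ?inE.
case/negP: vS; rewrite -(maxS (v |: S)%SET) ?finset.subsetUr ?setU11 //.
apply/asboolP => a b; rewrite !inE => /orP[/eqP->|aS] /orP[/eqP->|bS] // rab.
- by case: none; exists b.
- by case: none; exists a => //; apply: reach_sym.
- exact: sepS.
Qed.

Lemma distance_to_set (S : {set V}) :
  (forall v, exists2 s, s \in S & exists l, reach [set: V]%SET v s l) ->
  exists p : V -> R, [/\ forall v, 0 <= p v,
    forall u v l, reach [set: V]%SET u v l -> p u <= p v + l,
    forall v s l, s \in S -> reach [set: V]%SET v s l -> p v <= l &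
    forall v, v \notin S -> exists2 w, adj G v w & p w + weight G v w <= p v].
Proof.
move=> toS; pose P v q := path (adj G) v q /\ last v q \in S.
have ex v : exists q, P v q /\ forall q', P v q' -> walk_length G v q <= walk_length G v q'.
  have [q []//||q Pq minq] := @shortest_walk v (P v); last by exists q.
  by have [s sS [l [q [h1 h2 _] _]]] := toS v; exists q; split; rewrite ?h2.
pose q v := sval (cid (ex v)).
have Pq v : P v (q v) by rewrite /q; case: cid => ? [].
have minq v q' : P v q' -> walk_length G v (q v) <= walk_length G v q'.
  by rewrite /q; case: cid => ? [? +] /=; apply.
exists (fun v => walk_length G v (q v)).
split=> [v|u v l [a [a1 a2 _] al]|v s l sS [a [a1 a2 _] al]|v vS].
- by apply: walk_length_ge0; case: (Pq v).
- have [b1 b2] := Pq v; apply: le_trans (minq u (a ++ q v) _) _.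
    by split; rewrite ?cat_path ?last_cat a2 ?a1.
  by rewrite walk_length_cat a2 addrC lerD2l.
- by apply: le_trans al; apply: minq; split; rewrite ?a2.
- have [] := Pq v; case E: (q v) => [|w b] /=; first by rewrite (negbTE vS).
  move=> /andP[vw b1] b2; exists w => //; rewrite addrC lerD2l.
  by apply: minq; split.
Qed.

End Walks.

(** * Aggregating clusters to portals *)

Lemma slow_growth_step (n : nat -> nat) (h : nat) :
  (0 < h)%N -> (n h < 2 ^ h.-1)%N -> exists2 j, (j < h)%N & (n j.+1 <= 2 * n j)%N.
Proof.
case: h => // h _ /= small.
case: (pselect (exists2 j, (j < h.+1)%N & (n j.+1 <= 2 * n j)%N)) => // none.
have fast j : (j < h.+1)%N -> (2 * n j < n j.+1)%N.
  by move=> jh; rewrite ltnNge; apply/negP => slow; case: none; exists j.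
suff: (2 ^ h <= n h.+1)%N by rewrite leqNgt small.
elim: h fast {small none} => [|h IH] fast; first by apply: leq_ltn_trans (fast 0%N _).
rewrite expnS; apply: leq_trans (ltnW (fast h.+1 _)) => //; rewrite leq_mul2l /=.
by apply: IH => j jh; apply: fast; apply: ltnW.
Qed.

Lemma card_imset_setU_disjoint (aT rT : finType) (c : aT -> rT) (A B : {set aT}) :
  (forall x y, x \in A -> y \in B -> c x <> c y) ->
  #|(c @: (A :|: B))%SET| = (#|(c @: A)%SET| + #|(c @: B)%SET|)%N.
Proof.
move=> dis; rewrite imsetU cardsU (_ : _ :&: _ = finset.set0)%SET ?cards0 ?subn0 //.
apply/setP => z; rewrite !inE; apply/negbTE/negP => /andP[/imsetP[x xA ->] /imsetP[y yB]].
exact: dis.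
Qed.

Section Aggregation.
Variables (R : realType) (V : finType) (G : wgraph R V).
Hypothesis weight_ge1 : forall u v, adj G u v -> 1 <= weight G u v.
Variables (c : V -> V) (Dl : R) (p : V -> R) (S : {set V}).
Hypothesis Dl0 : 0 <= Dl.
Hypothesis cluster_diam :
  forall u v, c u = c v -> reach G [set x | c x == c u]%SET u v Dl.
Hypothesis p_lip : forall u v l, reach G [set: V]%SET u v l -> p u <= p v + l.

Definition owned (f : V -> option V) (s : V) : {set V} := [set v | f v == Some s]%SET.
Definition unowned (f : V -> option V) : {set V} := [set v | f v == None]%SET.

Definition extends (f g : V -> option V) := forall v s, f v = Some s -> g v = Some s.

Definition assigned (f : V -> option V) (b : R) : Prop :=
  (forall u v, c u = c v -> f u = f v) /\
  (forall v s, f v = Some s -> s \in S /\ reach G (owned f s) v s (p v + b)).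

Definition grow (f : V -> option V) (s : V) (r : R) : {set V} :=
  [set v in unowned f | `[< reach G (unowned f :|: owned f s) v s (p v + r) >]]%SET.

Definition settle (f : V -> option V) (s : V) (r : R) (v : V) : option V :=
  if (f v == None) && (c v \in c @: grow f s r)%SET then Some s else f v.

Lemma extends_trans f g k : extends f g -> extends g k -> extends f k.
Proof. by move=> fg gk v s /fg/gk. Qed.

Lemma unowned_extends f g : extends f g -> unowned g \subset unowned f.
Proof.
move=> fg; apply/fintype.subsetP => v; rewrite !inE; case E: (f v) => [s|] //.
by rewrite (fg _ _ E).
Qed.

Lemma owned_extends f g s : extends f g -> owned f s \subset owned g s.
Proof.
by move=> fg; apply/fintype.subsetP => v; rewrite !inE => /eqP/fg ->.
Qed.

Lemma settle_extends f s r : extends f (settle f s r).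
Proof. by move=> v t fv; rewrite /settle fv. Qed.

Lemma assigned_le f b b' : b <= b' -> assigned f b -> assigned f b'.
Proof.
move=> bb' [h1 h2]; split=> // v s /h2[sS vs]; split=> //.
by apply: reach_le vs; rewrite lerD2l.
Qed.

Lemma grow_le f s r r' : r <= r' -> grow f s r \subset grow f s r'.
Proof.
move=> rr'; apply/fintype.subsetP => v; rewrite !inE => /andP[-> /asboolP vr] /=.
by apply/asboolP; apply: reach_le vr; rewrite lerD2l.
Qed.

(* Since [p] is 1-Lipschitz, the excess [d(v, s) - p v] does not increase along a
   shortest walk to [s], so such a walk never leaves its sublevel set. *)
Lemma grow_closed f s r u :
  reach G (unowned f :|: owned f s)%SET u s (p u + r) ->
  reach G (grow f s r :|: owned f s)%SET u s (p u + r).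
Proof.
move=> [q wq lq]; exists q => //.
have memg v q' : is_walk G (unowned f :|: owned f s)%SET v s q' ->
    walk_length G v q' <= p v + r -> v \in (grow f s r :|: owned f s)%SET.
  move=> wq' lq'; have [_ _ /= /andP[vW _]] := wq'.
  move: vW; rewrite !inE => /orP[vN|->]; last by rewrite orbT.
  by rewrite vN /=; apply/orP; left; apply/asboolP; exists q'.
elim: q u wq lq => [|w q IH] u wq lq; have uin := memg _ _ wq lq.
  by case: wq => *; split; rewrite //= uin.
have [/= /andP[uw wp] lastq /andP[uW qW]] := wq.
have [||h1 h2 h3] := IH w; first by split.
  have : p u <= p w + weight G u w.
    by apply: p_lip; apply: reach_edge; rewrite ?finset.in_setT.
  by move: lq => /=; lra.
by split; rewrite //= ?uw // uin.
Qed.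

Lemma cluster_unowned f b u v :
  assigned f b -> f u = None -> c v = c u ->
  reach G (unowned f) v u Dl.
Proof.
move=> [fc _] fu vu; apply: reach_mono (cluster_diam vu); rewrite ?lexx //.
apply/fintype.subsetP => x; rewrite !inE => /eqP xv.
by rewrite (fc x u) ?fu // xv.
Qed.

Lemma grow_round f b s r u v :
  assigned f b -> u \in grow f s r -> c v = c u -> v \in grow f s (r + 2 * Dl).
Proof.
move=> af; rewrite !inE => /andP[/eqP fu /asboolP ur] vu.
have vuD := cluster_unowned af fu vu.
have -> /= : f v == None by case: (reach_ends vuD); rewrite !inE.
apply/asboolP; apply: reach_le (_ : Dl + (p u + r) <= _) _; last first.
  by apply: reach_trans ur; apply: reach_mono vuD; rewrite ?finset.subsetUl.
have := p_lip (reach_setT (reach_sym vuD)); lra.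
Qed.

Lemma settle_assigned f s r b :
  s \in S -> assigned f b -> r + 2 * Dl <= b -> assigned (settle f s r) b.
Proof.
move=> sS af rb; have [fc fr] := af; split=> [u v uv|v t].
  by rewrite /settle (fc _ _ uv) uv.
rewrite {1}/settle; case: ifP => [/andP[/eqP fv /imsetP[u ug vu]]|_ fv]; last first.
  have [tS vt] := fr _ _ fv; split=> //.
  by apply: reach_mono vt; rewrite ?lexx ?owned_extends //; apply: settle_extends.
case=> <-; split=> //; move: (ug); rewrite inE => /andP[]; rewrite inE => /eqP fu /asboolP ur.
apply: reach_le (_ : Dl + (p u + r) <= _) _.
  have := p_lip (reach_setT (reach_sym (cluster_unowned af fu vu))); lra.
apply: reach_trans (_ : reach G _ v u Dl) _.
  apply: reach_mono (cluster_diam vu); rewrite ?lexx //.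
  apply/fintype.subsetP => x; rewrite !inE /settle => /eqP xv.
  by rewrite (fc x v) // fv eqxx xv vu imset_f.
apply: reach_mono (grow_closed ur); rewrite ?lexx // finset.subUset.
rewrite (owned_extends s (@settle_extends f s r)) andbT.
apply/fintype.subsetP => x xg; rewrite !inE /settle imset_f //.
by move: xg; rewrite !inE => /andP[/eqP ->].
Qed.

Section Phase.
Variables (b E : R) (h : nat).
Hypothesis h0 : (0 < h)%N.
Hypothesis E0 : 0 <= E.
Hypothesis few : forall y, (#|(c @: gball G y E)%SET| < 2 ^ h.-1)%N.
Hypothesis radius : forall v, p v + (b + 2 * h%:R * Dl) <= E.

Let b' := b + 2 * h%:R * Dl.

Lemma serve f s : s \in S -> assigned f b' ->
  exists f' r, [/\ extends f f', assigned f' b', b <= r <= b',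
    unowned f :\: unowned f' \subset grow f s r &
    (#|c @: (grow f s r :&: unowned f')| <= #|c @: (unowned f :\: unowned f')|)%N]%SET.
Proof.
move=> sS af; pose rad j := b + 2 * j%:R * Dl.
have radS j : rad j.+1 = rad j + 2 * Dl by rewrite /rad -natr1; lra.
have rad_le i j : (i <= j)%N -> rad i <= rad j.
  by move=> ij; rewrite /rad lerD2l ler_wpM2r // ler_wpM2l // ler_nat.
have [|j jh slow] := @slow_growth_step (fun j => #|(c @: grow f s (rad j))%SET|) h h0.
  apply: leq_ltn_trans (few s); apply/subset_leq_card/imsetS/fintype.subsetP => v.
  rewrite inE => /andP[_ /asboolP vr]; apply/(gballP weight_ge1)/reach_sym/(reach_le (radius v)).
  exact: reach_setT vr.
have newE v : v \in (unowned f :\: unowned (settle f s (rad j)))%SET =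
    (f v == None) && (c v \in c @: grow f s (rad j))%SET.
  rewrite !inE /settle; case fv: (f v == None); rewrite ?andbF //= andbT.
  by case: (c v \in _); rewrite ?fv.
exists (settle f s (rad j)), (rad j.+1); split.
- exact: settle_extends.
- apply: settle_assigned => //; rewrite -radS; exact: rad_le.
- apply/andP; split; last exact: rad_le.
  by apply: le_trans (rad_le 0%N j.+1 _); rewrite // /rad mulr0 mul0r addr0.
- apply/fintype.subsetP => v; rewrite newE => /andP[_ /imsetP[u ug vu]].
  by rewrite radS; apply: grow_round af ug vu.
- set Ch := (_ :&: _)%SET; set New := (_ :\: _)%SET.
  have dis : #|(c @: (Ch :|: grow f s (rad j)))%SET| =
      (#|(c @: Ch)%SET| + #|(c @: grow f s (rad j))%SET|)%N.
    apply: card_imset_setU_disjoint => x y /setIP[_]; rewrite inE /settle => fx yg xy.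
    have yy : c y \in (c @: grow f s (rad j))%SET by apply: imset_f.
    move: fx; rewrite xy yy andbT (af.1 _ _ xy).
    by move: yg; rewrite !inE => /andP[-> _].
  have le1 : (#|(c @: (Ch :|: grow f s (rad j)))%SET| <= #|(c @: grow f s (rad j.+1))%SET|)%N.
    apply/subset_leq_card/imsetS; rewrite finset.subUset subsetIl /=.
    by apply: grow_le; apply: rad_le.
  have le2 : (#|(c @: grow f s (rad j))%SET| <= #|(c @: New)%SET|)%N.
    apply/subset_leq_card/imsetS/fintype.subsetP => v vg; rewrite newE imset_f // andbT.
    by move: vg; rewrite !inE => /andP[].
  move: dis le1 le2 slow; lia.
Qed.

(* The pointers [v -> w] with [p w + weight v w <= p v] lead from [v] through
   vertices that [f] leaves free to a vertex that [f0] gives to a member of [ss]. *)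
Inductive traced (f0 f : V -> option V) (ss : seq V) : V -> Prop :=
| traced_base v s of f0 v = Some s & s \in ss : traced f0 f ss v
| traced_step v w of f v = None & adj G v w & p w + weight G v w <= p v
    & traced f0 f ss w : traced f0 f ss v.

Lemma traced_serve f0 f f' s ss r :
  (forall v t, f0 v = Some t -> reach G (owned f0 t) v t (p v + b)) ->
  extends f0 f -> b <= r -> (unowned f :\: unowned f' \subset grow f s r)%SET ->
  forall v, traced f0 f (s :: ss) v ->
  traced f0 f' ss v \/ reach G (unowned f :|: owned f s)%SET v s (p v + r).
Proof.
move=> f0r f0f br /fintype.subsetP newg v; elim=> [{}v t f0v|{}v w fv vw pw _ [tr|wr]].
- rewrite inE => /orP[/eqP tE|tss]; last by left; apply: traced_base tss.
  right; rewrite -tE; apply: reach_mono (f0r _ _ f0v); rewrite ?lerD2l //.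
  by apply: fintype.subset_trans (owned_extends t f0f) _; rewrite finset.subsetUr.
- case f'v: (f' v) => [t|]; last by left; apply: traced_step tr.
  right; have : v \in grow f s r by apply: newg; rewrite !inE fv f'v.
  by rewrite !inE => /andP[_ /asboolP].
- right; apply: reach_le (_ : weight G v w + (p w + r) <= _) _; first by lra.
  apply: reach_trans (wr); apply: reach_edge => //; rewrite ?inE ?fv //.
  by have [] := reach_ends wr; rewrite !inE.
Qed.

Lemma sweep f0 :
  (forall v t, f0 v = Some t -> reach G (owned f0 t) v t (p v + b)) ->
  forall ss f, {subset ss <= S} -> extends f0 f -> assigned f b' ->
  exists f' (Ch : {set V}), [/\ extends f f', assigned f' b',
    forall v, traced f0 f ss v -> f' v = None -> v \in Ch &
    forall y r, (#|c @: (Ch :&: gball G y r)| <=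
      #|c @: ((unowned f :\: unowned f') :&: gball G y (r + 2 * E))|)%N]%SET.
Proof.
move=> f0r; elim=> [|s ss IH] f ssS f0f af.
  exists f, finset.set0; split=> // [v|y r]; last by rewrite finset.set0I imset0 cards0.
  by move=> tr _; elim: tr => [? ? _|? ? _ _ _ _]; rewrite ?in_nil ?finset.in_set0.
have [f1 [r1 [ff1 af1 /andP[br1 r1b] newg cardg]]] := serve (ssS s (mem_head _ _)) af.
have ssS' : {subset ss <= S} by move=> t tss; apply: ssS; rewrite inE tss orbT.
have [f' [Ch [f1f' af' trCh cardCh]]] := IH f1 ssS' (extends_trans f0f ff1) af1.
exists f', ((grow f s r1 :&: unowned f1) :|: Ch)%SET; split=> //.
- exact: extends_trans f1f'.
- move=> v /(traced_serve f0r f0f br1 newg) trv f'v.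
  have f1v : f1 v = None by case E1: (f1 v) => [t|] //; rewrite (f1f' _ _ E1) in f'v.
  have fv : f v = None by case fvE: (f v) => [t|] //; rewrite (ff1 _ _ fvE) in f1v.
  case: trv => [/trCh vCh|vr]; first by rewrite finset.in_setU vCh // orbT.
  by rewrite !inE fv f1v /=; apply/orP; left; rewrite andbT; apply/asboolP.
move=> y r; rewrite finset.setIUl imsetU.
apply: leq_trans (leq_card_setU _ _) _.
set new1 := (unowned f :\: unowned f1)%SET; set new2 := (unowned f1 :\: unowned f')%SET.
apply: leq_trans (_ : #|c @: (new1 :&: gball G y (r + 2 * E))|%SET +
   #|c @: (new2 :&: gball G y (r + 2 * E))|%SET <= _)%N; last first.
  rewrite -card_imset_setU_disjoint => [|u v].
    apply/subset_leq_card/imsetS; rewrite -finset.setIUl; apply: finset.setSI.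
    rewrite finset.subUset; apply/andP; split.
      by apply: finset.setDS; apply: unowned_extends.
    by apply: finset.setSD; apply: unowned_extends.
  rewrite !inE => /andP[/andP[f1u _] _] /andP[/andP[_ /eqP f1v] _] uv.
  by case: af1 => + _ => /(_ _ _ uv) f1uv; rewrite f1uv f1v in f1u.
apply: leq_add; last exact: cardCh.
have [->|[v]] := set_0Vmem (grow f s r1 :&: unowned f1 :&: gball G y r)%SET.
  by rewrite imset0 cards0.
have near x : x \in grow f s r1 -> reach G [set: V]%SET x s E.
  rewrite inE => /andP[_ /asboolP xs]; apply: reach_le (radius x) _.
  by apply: reach_le (reach_setT xs); rewrite lerD2l.
rewrite 2!inE => /andP[/andP[/near vs _] /(gballP weight_ge1) yv].
apply: leq_trans (_ : _ <= #|(c @: new1)%SET|)%N _.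
  by apply: leq_trans cardg; apply/subset_leq_card/imsetS; rewrite subsetIl.
apply/subset_leq_card/imsetS; rewrite finset.subsetI subxx /=.
apply/fintype.subsetP => x xn; apply/(gballP weight_ge1).
have /near xs : x \in grow f s r1 by apply: (fintype.subsetP newg).
have := reach_trans yv (reach_trans vs (reach_sym xs)); apply: reach_le; lra.
Qed.

Lemma phase f : assigned f b ->
  (forall v, f v = None -> exists2 w, adj G v w & p w + weight G v w <= p v) ->
  exists f', [/\ extends f f', assigned f' b' &
    forall y r, (2 * #|c @: (unowned f' :&: gball G y r)| <=
      #|c @: (unowned f :&: gball G y (r + 2 * E))|)%N]%SET.
Proof.
move=> af ptr.
have trace v : traced f f (enum S) v.
  have [n] := ubnP #|[set u | p u < p v]%SET|; elim: n v => // n IH v vn.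
  case fv: (f v) => [s|]; first by apply: traced_base (fv) _; rewrite mem_enum; case: (af.2 _ _ fv).
  have [w vw pw] := ptr v fv; apply: (traced_step fv vw pw (IH w _)).
  have lt_wv : p w < p v by have := weight_ge1 vw; lra.
  rewrite ltnS in vn; apply: leq_trans vn; apply: proper_card; apply/properP; split.
    by apply/fintype.subsetP => u; rewrite !inE => /lt_trans; apply.
  by exists w; rewrite !inE // ltxx.
have af' : assigned f b'.
  by apply: assigned_le af; rewrite lerDl mulr_ge0 // mulr_ge0.
have enumS : {subset enum S <= S} by move=> s; rewrite mem_enum.
have [f' [Ch [ff' aff' trCh cardCh]]] :=
  sweep (fun v s fv => (af.2 v s fv).2) enumS (fun _ _ => id) af'.
exists f'; split=> // y r.
have := cardCh y r; set A := (_ :&: _)%SET; set New := (_ :&: _)%SET => leA.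
have left : (#|c @: (unowned f' :&: gball G y r)|%SET <= #|(c @: A)%SET|)%N.
  apply/subset_leq_card/imsetS; apply: finset.setSI; apply/fintype.subsetP => v.
  by rewrite inE => /eqP; apply: trCh.
have dis : (#|(c @: (unowned f' :&: gball G y r :|: New))%SET| =
  #|(c @: (unowned f' :&: gball G y r))%SET| + #|(c @: New)%SET|)%N.
  apply: card_imset_setU_disjoint => u v; rewrite !inE.
  move=> /andP[/eqP f'u _] /andP[/andP[f'v _] _] uv.
  by rewrite -(aff'.1 _ _ uv) f'u in f'v.
have sub : (#|(c @: (unowned f' :&: gball G y r :|: New))%SET| <=
    #|c @: (unowned f :&: gball G y (r + 2 * E))|%SET)%N.
  apply/subset_leq_card/imsetS; rewrite finset.subUset; apply/andP; split.
    apply: finset.setISS; first exact: unowned_extends.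
    apply/fintype.subsetP => v /(gballP weight_ge1) yv.
    apply/(gballP weight_ge1); apply: reach_le yv.
    by rewrite lerDl mulr_ge0.
  by apply: finset.setSI; apply: finset.subsetDl.
lia.
Qed.

End Phase.
Lemma aggregate f0 (b E : R) (h : nat) :
  (0 < h)%N -> 0 <= E ->
  (forall y, (#|(c @: gball G y (h%:R * (2 * E)))%SET| < 2 ^ h.-1)%N) ->
  (forall v, p v + (b + h%:R * (2 * h%:R * Dl)) <= E) ->
  assigned f0 b ->
  (forall v, f0 v = None -> exists2 w, adj G v w & p w + weight G v w <= p v) ->
  exists c' : V -> V, [/\ forall v s, f0 v = Some s -> c' v = s,
    forall u v, c u = c v -> c' u = c' v,
    forall v, c' v \in S &
    forall v, reach G [set x | c' x == c' v]%SET v (c' v) E].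
Proof.
move=> h0 E0 few radius af0 ptr.
have few1 y : (#|(c @: gball G y E)%SET| < 2 ^ h.-1)%N.
  apply: leq_ltn_trans (few y); apply/subset_leq_card/imsetS/fintype.subsetP => v.
  move=> /(gballP weight_ge1) yv; apply/(gballP weight_ge1); apply: reach_le yv.
  have : 1 <= h%:R :> R by rewrite ler1n.
  nra.
have hDl0 : 0 <= 2 * h%:R * Dl by rewrite mulr_ge0 // mulr_ge0.
have iter t : (t <= h)%N -> exists f, [/\ extends f0 f,
    assigned f (b + t%:R * (2 * h%:R * Dl)) &
    forall y r, (2 ^ t * #|c @: (unowned f :&: gball G y r)| <=
      #|c @: (unowned f0 :&: gball G y (r + t%:R * (2 * E)))|)%N]%SET.
  elim: t => [|t IH] th.
    by exists f0; split=> // [|y r]; rewrite ?mul0r ?addr0 // expn0 mul1n.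
  have [f [f0f af halved]] := IH (ltnW th).
  have rad_t v : p v + (b + t%:R * (2 * h%:R * Dl) + 2 * h%:R * Dl) <= E.
    apply: le_trans (radius v); rewrite lerD2l -addrA lerD2l.
    by rewrite -{2}[2 * _ * Dl]mul1r -mulrDl natr1 ler_wpM2r // ler_nat.
  have ptr_f v : f v = None -> exists2 w, adj G v w & p w + weight G v w <= p v.
    by move=> fv; apply: ptr; case f0v: (f0 v) => [s|] //; rewrite (f0f _ _ f0v) in fv.
  have [f' [ff' af' half]] := phase h0 E0 few1 rad_t af ptr_f.
  exists f'; split=> [||y r].
  - exact: extends_trans ff'.
  - by apply: assigned_le af'; rewrite -[t.+1%:R]natr1; lra.
  - rewrite expnS -mulnA mulnCA; apply: leq_trans (leq_mul (leqnn _) (half y r)) _.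
    apply: leq_trans (halved _ _) _.
    rewrite (_ : r + 2 * E + _ = r + t.+1%:R * (2 * E)) //.
    by rewrite -[t.+1%:R]natr1; lra.
have [f [f0f af halved]] := iter h (leqnn h).
have total y : f y <> None.
  move=> fy; have := halved y 0; rewrite add0r leqNgt => /negP; apply.
  apply: (@leq_ltn_trans (2 ^ h.-1)%N).
    apply: leq_trans (ltnW (few y)); apply/subset_leq_card/imsetS; exact: subsetIr.
  apply: leq_trans (_ : 2 ^ h <= _)%N; first by rewrite ltn_exp2l // prednK.
  rewrite leq_pmulr //; apply/card_gt0P; exists (c y); apply: imset_f.
  rewrite finset.in_setI; apply/andP; split; first by rewrite inE fy.
  by apply/(gballP weight_ge1)/reach_refl; rewrite ?finset.in_setT.
pose c' v := odflt v (f v).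
have fE v : f v = Some (c' v) by rewrite /c'; case fv: (f v) => //; case: (total v).
exists c'; split=> [v s f0v|u v uv|v|v].
- by rewrite /c' (f0f _ _ f0v).
- by have := af.1 _ _ uv; rewrite !fE => -[].
- by case: (af.2 _ _ (fE v)).
- have [_] := af.2 _ _ (fE v); apply: reach_mono; last exact: radius.
  by apply/fintype.subsetP => x; rewrite !inE fE => /eqP[->].
Qed.

End Aggregation.

(** * Hierarchies *)

Lemma finite_uniform_bound (R : realType) (T : finType) (P : T -> R -> Prop) :
  (forall x l m, l <= m -> P x l -> P x m) -> (forall x, exists l, P x l) ->
  exists L, forall x, P x L.
Proof.
move=> Pmono Pex; suff [L LP] : exists L, forall x, x \in enum T -> P x L.
  by exists L => x; apply: LP; rewrite mem_enum.
elim: (enum T) => [|x s [L LP]]; first by exists 0.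
have [l Pl] := Pex x; exists (Num.max l L) => y; rewrite inE => /orP[/eqP->|ys].
  by apply: Pmono Pl; rewrite le_max lexx.
by apply: Pmono (LP y ys); rewrite le_max lexx orbT.
Qed.

Section Levels.
Variables (R : realType) (V : finType) (G : wgraph R V).
Hypothesis weight_ge1 : forall u v, adj G u v -> 1 <= weight G u v.
Hypothesis conn : gconnected G.
Variables (kappa k h : nat).
Hypothesis doubling : has_doubling_dim G kappa%:R.

Let mu : R := 8 + 8 * h%:R ^+ 2.

Hypothesis h_gt0 : (0 < h)%N.
Hypothesis k_large : 12 * (h%:R * mu + 1) <= 2 ^+ k :> R.
Hypothesis h_large : (kappa * k < h.-1)%N.

(* A partition into clusters of scale [Dl], encoded by the map sending a vertex to
   a centre labelling its cluster. *)
Definition is_level (Dl : R) (c : V -> V) : Prop :=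
  [/\ forall u v, c u = c v -> reach G [set x | c x == c u]%SET u v Dl,
      far_apart G (Dl / 6) (c @: [set: V])%SET &
      forall v, reach G [set: V]%SET v (c v) Dl].

Lemma level_few Dl c y r : 0 < Dl -> 0 <= r -> r <= h%:R * mu * Dl -> is_level Dl c ->
  (#|(c @: gball G y r)%SET| <= 2 ^ (kappa * k))%N.
Proof.
move=> Dl0 r0 rle [_ sepc near].
apply: (separated_card weight_ge1 doubling (sep := Dl / 6) (L := r + Dl) (y := y)).
- lra.
- move: k_large => /(ler_wpM2l (ltW Dl0)); lra.
- move=> u v /imsetP[u' _ ->] /imsetP[v' _ ->]; apply: sepc; apply: imset_f; exact: finset.in_setT.
- apply/fintype.subsetP => _ /imsetP[u /(gballP weight_ge1) yu ->].
  by apply/(gballP weight_ge1); apply: reach_trans yu (near u).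
Qed.

Lemma reach_in_gball s u r :
  reach G [set: V]%SET s u r -> reach G (gball G s r) s u r.
Proof.
have walk_in q : forall x l, is_walk G [set: V]%SET x u q -> l + walk_length G x q <= r ->
    reach G [set: V]%SET s x l -> is_walk G (gball G s r) x u q.
  elim: q => [|w q IH] x l [pq lastq _] lq sx.
    split=> //=; rewrite andbT; apply/(gballP weight_ge1)/(reach_le _ sx).
    by rewrite /= addr0 in lq.
  have xin : x \in gball G s r.
    apply/(gballP weight_ge1)/(reach_le _ sx).
    by have := walk_length_ge0 weight_ge1 pq; lra.
  have [/= /andP[xw wp]] := pq.
  have [|||h1 h2 h3] := IH w (l + weight G x w); last by split; rewrite //= ?xw // xin.
  - by split=> //; apply/allP => z _; rewrite /= finset.in_setT.
  - by move: lq => /=; lra.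
  - by apply: reach_trans sx _; apply: reach_edge; rewrite ?finset.in_setT.
move=> [q wq lq]; exists q => //; apply: (walk_in q s 0) => //; first by rewrite add0r.
by apply: reach_refl; rewrite ?finset.in_setT.
Qed.

Lemma connected_reach u v : exists l, reach G [set: V]%SET u v l.
Proof.
have /connectP[q pq ->] := conn.2 u v; exists (walk_length G u q); exists q => //.
by split=> //; apply/allP => z _; rewrite /= finset.in_setT.
Qed.

Lemma next_level Dl c N : 0 < Dl -> is_level Dl c ->
  far_apart G (mu * Dl / 6 + Dl) N ->
  exists c', [/\ is_level (mu * Dl) c', forall u v, c u = c v -> c' u = c' v &
    forall x u, x \in N -> reach G [set: V]%SET x u (mu * Dl / 12) -> c' u = c' x].
Proof.
move=> Dl0 lc sepN; have [cdiam _ _] := lc.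
have mu8 : 8 <= mu by rewrite /mu lerDl mulr_ge0 // exprn_ge0.
pose rp := mu * Dl / 12.
have rp0 : 0 < rp by rewrite /rp; nra.
pose r0 := 2 * rp + Dl.
have r0E : mu * Dl / 6 + Dl = r0 by rewrite /r0 /rp; lra.
rewrite r0E in sepN.
have [|S [NS sepS netS]] := maximal_separated _ sepN; first by rewrite /r0; lra.
have [v|p [p0 p_lip pS ptr]] := @distance_to_set _ _ G weight_ge1 S.
  by have [s sS _] := netS v; exists s => //; apply: connected_reach.
have p_le v : p v <= r0 by have [s sS vs] := netS v; apply: pS sS vs.
pose near_portal v s := [exists u, (c u == c v) && (u \in gball G s rp)].
pose f0 v := [pick s in S | near_portal v s].
have near_uniq v s t : s \in S -> t \in S -> near_portal v s -> near_portal v t -> s = t.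
  move=> sS tS /existsP[u /andP[/eqP uv /(gballP weight_ge1) su]].
  move=> /existsP[w /andP[/eqP wv /(gballP weight_ge1) tw]]; apply: sepS => //.
  have uw : reach G [set: V]%SET u w Dl by apply: reach_setT (cdiam u w _); rewrite uv wv.
  by apply: reach_le (reach_trans su (reach_trans uw (reach_sym tw))); rewrite /r0; lra.
have f0P v s : f0 v = Some s <-> s \in S /\ near_portal v s.
  rewrite /f0; case: pickP => [t /andP[tS vt]|none].
    by split=> [[<-] //|[sS vs]]; congr Some; apply: near_uniq vt vs.
  by split=> // -[sS vs]; have := none s; rewrite /= sS vs.
have f0_ball s u : s \in S -> reach G [set: V]%SET s u rp -> f0 u = Some s.
  move=> sS su; apply/f0P; split=> //; apply/existsP; exists u; rewrite eqxx.
  exact/(gballP weight_ge1).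
have assigned0 : assigned G c p S f0 (rp + Dl).
  split=> [u v uv|v s].
    by rewrite /f0; apply: eq_pick => s; rewrite /near_portal uv.
  move=> f0v; have [sS /existsP[u /andP[/eqP uv /(gballP weight_ge1) su]]] := (f0P v s).1 f0v.
  split=> //; apply: reach_le (_ : Dl + rp <= _) _; first by have := p0 v; lra.
  apply: reach_trans (_ : reach G _ v u Dl) _.
    apply: reach_mono (cdiam v u _); rewrite ?lexx //.
    apply/fintype.subsetP => x; rewrite !inE => /eqP xv.
    by rewrite -f0v /f0; apply/eqP/eq_pick => t; rewrite /near_portal xv.
  apply: reach_mono (reach_sym (reach_in_gball su)); rewrite ?lexx //.
  apply/fintype.subsetP => x /(gballP weight_ge1) sx; rewrite inE; apply/eqP.
  exact: f0_ball.
pose E := mu * Dl / 2.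
have hE : h%:R * (2 * E) = h%:R * mu * Dl by rewrite /E; lra.
have muh : mu = 8 + 8 * (h%:R * h%:R) by rewrite /mu expr2.
have [|y|v||v f0v|c' [c'f0 c'c c'S c'r]] :=
    @aggregate _ _ G weight_ge1 c Dl p S (ltW Dl0) cdiam p_lip f0 (rp + Dl) E h h_gt0.
- by rewrite /E; nra.
- rewrite hE; apply: leq_ltn_trans (level_few y Dl0 _ (lexx _) lc) _.
    by rewrite mulr_ge0 ?mulr_ge0 // ltW // (lt_le_trans _ mu8).
  by rewrite ltn_exp2l.
- have := p_le v; rewrite /r0 /rp /E muh; nra.
- exact: assigned0.
- apply: ptr; apply/negP => vS.
  by rewrite (f0_ball v v) // in f0v; apply: reach_refl; rewrite ?finset.in_setT // ltW.
have E2 : E + E = mu * Dl by rewrite /E; lra.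
have c'pad x u : x \in S -> reach G [set: V]%SET x u rp -> c' u = x.
  by move=> xS xu; apply: c'f0; apply: f0_ball.
exists c'; split=> // [|x u xN xu].
  split=> [u v uv|_ _ /imsetP[u _ ->] /imsetP[v _ ->] uv|v].
  - rewrite -E2; apply: reach_trans (c'r u) _.
    by apply: reach_sym; rewrite uv; apply: c'r.
  - apply: sepS => //; apply: reach_le uv; rewrite -r0E; lra.
  - apply: reach_le (reach_setT (c'r v)); rewrite -E2 lerDl /E; nra.
have xS : x \in S by apply: (fintype.subsetP NS).
rewrite (c'pad x u) // (c'pad x x) //; apply: reach_refl; rewrite ?finset.in_setT //.
exact: ltW.
Qed.

Lemma colored_net (r : R) : 0 < r ->
  exists N : nat -> {set V}, (forall j, far_apart G (6 * r) (N j)) /\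
    forall v, exists j, (j < 2 ^ (kappa * 4))%N /\
      exists2 x, x \in N j & reach G [set: V]%SET v x r.
Proof.
move=> r0; have [||Y [_ sepY netY]] := @maximal_separated _ _ G r finset.set0.
- exact: ltW.
- by move=> u v; rewrite finset.in_set0.
pose e u v := `[< reach G [set: V]%SET u v (6 * r) >].
have e_sym : symmetric e by move=> u v; apply/asboolP/asboolP => /reach_sym.
have [y yY|col [colK colP]] := @proper_coloring _ e (2 ^ (kappa * 4)) Y e_sym.
  have cardle : (#|[set z in Y | e y z]%SET| <= 2 ^ (kappa * 4))%N.
    apply: (separated_card weight_ge1 doubling (sep := r) (L := 6 * r) (y := y)).
    - lra.
    - lra.
    - by move=> u v; rewrite !inE => /andP[uY _] /andP[vY _]; apply: sepY.
    - apply/fintype.subsetP => u; rewrite inE => /andP[_ /asboolP yu].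
      exact/(gballP weight_ge1).
  apply: leq_trans cardle; apply: proper_card; apply/properP; split.
    by apply/fintype.subsetP => z; rewrite !inE => /and3P[-> ->].
  exists y; rewrite !inE ?eqxx ?andbF // yY; apply/asboolP/reach_refl; rewrite ?finset.in_setT //.
  by rewrite mulr_ge0 // ltW.
exists (fun j => [set y in Y | col y == j]%SET); split=> [j u v|v].
  rewrite !inE => /andP[uY /eqP uj] /andP[vY /eqP vj] uv; apply: colP => //.
    exact/asboolP.
  by rewrite uj vj.
have [y yY vy] := netY v; exists (col y); split; first exact: colK.
by exists y; rewrite // inE yY eqxx.
Qed.

Lemma mu_ge16 : 16 <= mu.
Proof.
have h1 : 1 <= h%:R :> R by rewrite ler1n.
by rewrite /mu expr2; nra.
Qed.

Lemma level_tower (N : nat -> {set V}) :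
  (forall i, far_apart G (mu ^+ i / 4) (N i)) ->
  exists c : nat -> V -> V, [/\ c 0%N = id, forall i, is_level (mu ^+ i) (c i),
    forall i u v, c i u = c i v -> c i.+1 u = c i.+1 v &
    forall i x u, x \in N i -> reach G [set: V]%SET x u (mu ^+ i / 12) -> c i u = c i x].
Proof.
move=> sepN; have mu16 := mu_ge16.
have mui i : 0 < mu ^+ i by rewrite exprn_gt0 // (lt_le_trans _ mu16).
have lt12 (x y : V) : reach G [set: V]%SET x y (mu ^+ 0 / 12) -> x = y.
  by move/(reach_lt1 weight_ge1); apply; rewrite expr0; lra.
have level0 : is_level (mu ^+ 0) (@id V).
  split=> [u v uv|u v _ _|v].
  - by rewrite -uv; apply: reach_refl; rewrite ?inE.
  - by move/(reach_lt1 weight_ge1); apply; rewrite expr0; lra.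
  - by apply: reach_refl; rewrite ?finset.in_setT.
pose T i := {c : V -> V | is_level (mu ^+ i) c}.
have step i (c : T i) : {c' : T i.+1 |
    (forall u v, sval c u = sval c v -> sval c' u = sval c' v) /\
    forall x u, x \in N i.+1 -> reach G [set: V]%SET x u (mu ^+ i.+1 / 12) ->
      sval c' u = sval c' x}.
  apply: cid; case: c => c lc /=.
  have [|c' [lc' cc' c'N]] := @next_level (mu ^+ i) c (N i.+1) (mui i) lc.
    move=> u v uN vN uv; apply: (sepN i.+1) => //; apply: reach_le uv; rewrite exprS.
    by have := mui i; nra.
  by rewrite -exprS in lc' c'N; exists (exist _ c' lc').
pose tower := nat_rect T (exist _ id level0) (fun i c => sval (step i c)).
exists (fun i => sval (tower i)); split=> //.
- by move=> i; case: (tower i).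
- by move=> i u v; apply: (svalP (step i (tower i))).1.
- case=> [x u _ /lt12 -> //|i x u]; exact: (svalP (step i (tower i))).2.
Qed.

Definition clusters (c : V -> V) : {set {set V}} := preim_partition c [set: V]%SET.

Lemma clustersP c C :
  reflect (exists v, C = [set x | c x == c v]%SET) (C \in clusters c).
Proof.
have E v : [set y in [set: V] | c v == c y]%SET = [set x | c x == c v]%SET.
  by apply/setP => y; rewrite !inE eq_sym.
apply: (iffP imsetP) => [[v _ ->]|[v ->]]; first by exists v; exact: E.
by exists v; rewrite ?finset.in_setT //; symmetry; exact: E.
Qed.

Lemma hierarchy_of_net (N : nat -> {set V}) :
  (forall i, far_apart G (mu ^+ i / 4) (N i)) ->
  exists P : seq {set {set V}}, [/\ strong_hp G mu P,
    max_degree_le P ((2 ^ (kappa * k))%:R : R) &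
    forall i x, x \in N i ->
      exists2 C, C \in level P i & gball G x (mu ^+ i / 12) \subset C].
Proof.
move=> sepN.
have mu16 := mu_ge16.
have mui i : 0 < mu ^+ i by rewrite exprn_gt0 // (lt_le_trans _ mu16).
have [L Ldiam] : exists L, forall uv : V * V, reach G [set: V]%SET uv.1 uv.2 L.
  apply: finite_uniform_bound => [uv l m lm|uv]; last exact: connected_reach.
  exact: reach_le.
pose I := (Num.truncn (6 * L)).+1.
have L_le : L <= mu ^+ I / 6.
  have lt1 : 6 * L < I%:R by exact: truncnS_gt.
  suff lt2 : I%:R <= mu ^+ I by lra.
  apply: le_trans (_ : 2 ^+ I <= _); last by rewrite lerXn2r ?nnegrE; lra.
  by rewrite -natrX ler_nat ltnW // ltn_expl.
have [c [c0 lc cc cN]] := level_tower sepN.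
have top u v : c I u = c I v.
  have [_ sep _] := lc I; apply: sep; try by apply: imset_f; rewrite finset.in_setT.
  exact: reach_le (Ldiam (_, _)).
pose P := mkseq (fun i => clusters (c i)) I.+1.
have levelE i : (i < I.+1)%N -> level P i = clusters (c i) by move=> iI; rewrite /level nth_mkseq.
have sizeP : size P = I.+1 by rewrite size_mkseq.
have [v0 _] : exists v0 : V, v0 \in V by apply/card_gt0P; exact: conn.1.
exists P; split.
- split; rewrite ?sizeP //.
  + by move=> i iI; rewrite levelE //; apply: preim_partitionP.
  + split=> [C|].
      rewrite levelE // c0 => /clustersP[v ->].
      by rewrite (_ : [set x | _]%SET = [set v]%SET) ?cards1 //; apply/setP => x; rewrite !inE.
    rewrite levelE //; apply/setP => C; rewrite finset.in_set1.
    have fib v : [set x | c I x == c I v]%SET = [set: V]%SET.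
      by apply/setP => x; rewrite !inE (top x v) eqxx.
    by apply/clustersP/eqP => [[v ->]|->]; [|exists v0].
  + move=> i C iI; rewrite levelE // => /clustersP[w ->] u v; rewrite !inE => /eqP uw /eqP vw.
    have [diam _ _] := lc i; apply/dist_inP => //; rewrite -uw; apply: diam; by rewrite uw.
  + move=> i C iI; rewrite levelE // => /clustersP[w ->]; apply/setP => x.
    apply/finset.bigcupP/idP => [[D]|xw].
      by move=> /finset.setIdP[_ /fintype.subsetP DC] /DC.
    exists [set y | c i y == c i x]%SET; last by rewrite inE.
    rewrite /children inE levelE ?(ltnW iI) //.
    apply/andP; split; first by apply/clustersP; exists x.
    apply/fintype.subsetP => y; rewrite inE => /eqP /cc yx.
    by rewrite inE yx; rewrite inE in xw.
- move=> i C; rewrite sizeP => iI; rewrite levelE // => /clustersP[w ->]; rewrite ler_nat.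
  have [diam _ _] := lc i.+1.
  apply: leq_trans (level_few w (mui i) _ _ (lc i)); last first.
  + have : 1 <= h%:R :> R by rewrite ler1n.
    move=> h1; apply: (_ : mu ^+ i.+1 <= _); rewrite exprS -mulrA ler_peMl // mulr_ge0 ?ltW //.
    by rewrite (lt_le_trans _ mu16).
  + by rewrite ltW.
  pose fib l := [set y | c i y == l]%SET.
  apply: leq_trans (leq_imset_card fib _).
  apply/subset_leq_card/fintype.subsetP => D; rewrite /children inE levelE ?(ltnW iI) //.
  move=> /andP[/clustersP[x ->] /fintype.subsetP sub]; apply/imsetP; exists (c i x) => //.
  apply: imset_f; have xw : x \in [set x | c i.+1 x == c i.+1 w]%SET by apply: sub; rewrite inE.
  apply/(gballP weight_ge1)/(reach_setT (diam w x _)).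
  by move: xw; rewrite inE => /eqP.
- move=> i x xN; have [iI|Ii] := ltnP i I.+1; last first.
    exists [set: V]%SET; last exact: finset.subsetT.
    by rewrite /level nth_default ?sizeP // finset.in_set1.
  rewrite levelE //; exists [set y | c i y == c i x]%SET; first by apply/clustersP; exists x.
  apply/fintype.subsetP => u /(gballP weight_ge1) xu.
  by rewrite inE; apply/eqP/(cN i x u xN).
Qed.

Lemma hierarchical_family :
  exists F : seq (seq {set {set V}}), [/\ strong_hpf G 24 mu F,
    size F = (2 ^ (kappa * 4))%N &
    forall P, P \in F -> max_degree_le P ((2 ^ (kappa * k))%:R : R)].
Proof.
have mu16 := mu_ge16.
have mui i : 0 < mu ^+ i by rewrite exprn_gt0 // (lt_le_trans _ mu16).
have net i : {N : nat -> {set V} | (forall j, far_apart G (6 * (mu ^+ i / 24)) (N j)) /\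
    forall v, exists j, (j < 2 ^ (kappa * 4))%N /\
      exists2 x, x \in N j & reach G [set: V]%SET v x (mu ^+ i / 24)}.
  by apply: cid; apply: colored_net; rewrite divr_gt0.
pose N j i := sval (net i) j.
have sepN j i : far_apart G (mu ^+ i / 4) (N j i).
  move=> u v uN vN uv; apply: (svalP (net i)).1 uN vN _; apply: reach_le uv; lra.
pose P j := sval (cid (hierarchy_of_net (sepN j))).
have PP j : [/\ strong_hp G mu (P j), max_degree_le (P j) ((2 ^ (kappa * k))%:R : R) &
    forall i x, x \in N j i ->
      exists2 C, C \in level (P j) i & gball G x (mu ^+ i / 12) \subset C].
  by rewrite /P; case: cid.
exists [seq P j | j <- iota 0 (2 ^ (kappa * 4))]; split.
- split=> //; first by lra.
    by move=> _ /mapP[j _ ->]; case: (PP j).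
  move=> v i; have [j [jK [x xN vx]]] := (svalP (net i)).2 v.
  exists (P j); first by apply: map_f; rewrite mem_iota.
  have [_ _ /(_ i x xN)[C CP xC]] := PP j; exists C => //.
  apply: fintype.subset_trans xC; apply/fintype.subsetP => u /(gballP weight_ge1) vu.
  apply/(gballP weight_ge1); apply: reach_le (reach_trans (reach_sym vx) vu).
  by have := mui i; lra.
- by rewrite size_map size_iota.
- by move=> _ /mapP[j _ ->]; case: (PP j).
Qed.

End Levels.

(** * Numerical constants *)

Lemma sqr_le_expn2 n : (n ^ 2 <= 2 ^ n.+1)%N.
Proof.
elim: n => // n IH; have [|n3] := ltnP n 3; first by case: n {IH} => [|[|[]]].
by move: IH; rewrite [(2 ^ n.+2)%N]expnS; nia.
Qed.

Section Constants.
Variable R : realType.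

Definition dim_nat (d : R) : nat := (Num.truncn (Num.max d 1)).+1.
Definition dim_log (d : R) : nat := (trunc_log 2 (dim_nat d)).+1.
Definition phases (d : R) : nat := (32 * (dim_nat d * dim_log d))%N.
Definition growth (d : R) : R := 8 + 8 * (phases d)%:R ^+ 2.

Lemma dim_nat_ge d : d <= (dim_nat d)%:R.
Proof.
by apply: ltW; apply: le_lt_trans (truncnS_gt _); rewrite le_max lexx.
Qed.

Lemma dim_nat_le d : 1 <= d -> (dim_nat d)%:R <= 2 * d.
Proof.
move=> d1; rewrite /dim_nat (max_idPl d1) -natr1.
have : (Num.truncn d)%:R <= d by rewrite truncn_le (le_trans _ d1).
lra.
Qed.

Lemma dim_nat_lt_exp d : (dim_nat d < 2 ^ dim_log d)%N.
Proof. exact: trunc_log_ltn. Qed.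

Lemma dim_log_exp d : (2 ^ (dim_log d) <= 2 * dim_nat d)%N.
Proof. by rewrite expnS leq_mul2l /= trunc_logP. Qed.

Lemma phases_cube d : (phases d ^ 3 <= 2 ^ (15 + 6 * dim_log d))%N.
Proof.
have -> : (2 ^ (15 + 6 * dim_log d) = (32 * (2 ^ dim_log d * 2 ^ dim_log d)) ^ 3)%N.
  by rewrite -expnD -[32%N]/(2 ^ 5)%N -expnD -expnM; congr (2 ^ _)%N; lia.
rewrite leq_exp2r // leq_mul2l /= leq_mul // ltnW //; first exact: dim_nat_lt_exp.
exact: ltn_expl.
Qed.

Lemma phases_gt0 d : (0 < phases d)%N.
Proof. by []. Qed.

Lemma growth_exponent d :
  12 * ((phases d)%:R * growth d + 1) <= 2 ^+ (29 * dim_log d) :> R.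
Proof.
have ph : 1 <= (phases d)%:R :> R by rewrite ler1n.
apply: le_trans (_ : 256 * (phases d)%:R ^+ 3 <= _).
  have := ler_eXnr (isT : 0 < 3)%N ph; rewrite /growth; lra.
rewrite -!natrX -natrM ler_nat.
apply: leq_trans (leq_mul (leqnn 256) (phases_cube d)) _.
rewrite -[256%N]/(2 ^ 8)%N -expnD leq_exp2l //; rewrite /dim_log; lia.
Qed.

Lemma phases_exponent d : (dim_nat d * (29 * dim_log d) < (phases d).-1)%N.
Proof.
rewrite /phases; have : (0 < dim_nat d * dim_log d)%N by [].
by move: (dim_nat d) (dim_log d) => a b; nia.
Qed.

Lemma growth_ge_exp d : 2 ^+ dim_log d <= growth d.
Proof.
have ph : 1 <= (phases d)%:R :> R by rewrite ler1n.
apply: le_trans (_ : (phases d)%:R <= _); last by rewrite /growth expr2; nra.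
rewrite -natrX ler_nat; apply: leq_trans (dim_log_exp d) _.
by rewrite /phases /dim_log; nia.
Qed.

Lemma growth_gt0 d : 0 < growth d.
Proof. by apply: lt_le_trans (growth_ge_exp d); rewrite exprn_gt0. Qed.

Lemma degree_le_growth d :
  (2 ^ (dim_nat d * (29 * dim_log d)))%:R <= growth d `^ (29 * dim_nat d)%:R.
Proof.
rewrite powR_mulrn; last exact: ltW (growth_gt0 d).
have -> : (dim_nat d * (29 * dim_log d) = dim_log d * (29 * dim_nat d))%N by lia.
by rewrite natrX exprM lerXn2r ?nnegrE ?growth_ge_exp ?exprn_ge0 //; exact: ltW (growth_gt0 d).
Qed.

Lemma phases_sqr_le d : (phases d ^ 2 <= (16 * dim_nat d) ^ 3)%N.
Proof.
have le_log : (dim_log d ^ 2 <= 4 * dim_nat d)%N.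
  apply: leq_trans (sqr_le_expn2 _) _; rewrite expnS.
  by have := dim_log_exp d; lia.
have -> : (phases d ^ 2 = (32 * dim_nat d) ^ 2 * dim_log d ^ 2)%N.
  by rewrite /phases mulnA expnMn.
have -> : ((16 * dim_nat d) ^ 3 = (32 * dim_nat d) ^ 2 * (4 * dim_nat d))%N.
  by rewrite !expnS !expn0 !muln1; lia.
by rewrite leq_mul2l le_log orbT.
Qed.

Lemma growth_softO : is_softO growth (fun d => d ^+ 3).
Proof.
exists (8 + 8 * 32 ^+ 3), 0%N => d d1.
rewrite expr0 mulr1 ger0_norm; last exact: ltW (growth_gt0 d).
have le_ph : (phases d)%:R ^+ 2 <= 32 ^+ 3 * d ^+ 3 :> R.
  apply: le_trans (_ : (16 * dim_nat d)%:R ^+ 3 <= _).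
    by rewrite -!natrX ler_nat phases_sqr_le.
  rewrite -exprMn lerXn2r ?nnegrE // ?natrM; have := dim_nat_le d1; lra.
have d3 : 1 <= d ^+ 3 by rewrite exprn_ege1.
rewrite /growth; move: (32 ^+ 3) le_ph => y le_ph; lra.
Qed.

End Constants.

Theorem theorem3p4 (R : realType) :
  exists (rho : R) (mu size_exp deg_exp : R -> R),
    [/\ is_softO mu (fun d => d ^+ 3),
        is_softO size_exp (fun d => d),
        is_bigO deg_exp (fun d => d)
      & forall (V : finType) (G : wgraph R V) (d : R),
          gconnected G ->
          (forall u v : V, adj G u v -> 1 <= weight G u v) ->
          has_doubling_dim G d ->
          exists F : seq (seq {set {set V}}),
            [/\ strong_hpf G rho (mu d) F,
                (size F)%:R <= 2 `^ size_exp d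
              & forall P, P \in F -> max_degree_le P (mu d `^ deg_exp d)]].
Proof.
exists 24, (@growth R), (fun d => (dim_nat d * 4)%:R), (fun d => (29 * dim_nat d)%:R).
split; first exact: growth_softO.
- exists 8, 0%N => d d1; rewrite expr0 mulr1 ger0_norm // natrM.
  by have := dim_nat_le d1; lra.
- exists 58 => d d1; rewrite ger0_norm // natrM.
  by have := dim_nat_le d1; lra.
move=> V G d conn weight_ge1 doubling_d.
have doubling : has_doubling_dim G (dim_nat d)%:R.
  move=> v r r0; have [S cardS cover] := doubling_d v r r0; exists S => //.
  by apply: le_trans cardS _; rewrite ler_powR ?dim_nat_ge // ler1n.
have [F [hpf sizeF degF]] := hierarchical_family weight_ge1 conn doubling
  (phases_gt0 d) (growth_exponent d) (phases_exponent d).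
exists F; split=> //.
  by rewrite sizeF powR_mulrn // natrX.
move=> P PF i C iP CP; apply: le_trans (degF P PF i C iP CP) _.
exact: degree_le_growth.
Qed.
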